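(* For each $n\in\mathbb N$ with $n>11$, there exists an $n$-ary Boolean function $f:\mathbb B^n\to\mathbb B$ such that, for each $X\in\mathcal{IS}_{br}$ that computes $f$, $|X|>\lfloor 2^n/n\rfloor$.
   Context: Let $\mathbb B=\{\mathsf T,\mathsf F\}$. There are Boolean registers named $\mathtt{in}{:}i$ ($i\ge1$), $\mathtt{aux}{:}i$ ($i\ge1$) and $\mathtt{out}$, processing methods $\mathtt{set{:}T}$ (content becomes $\mathsf T$, reply $\mathsf T$), $\mathtt{set{:}F}$ (content becomes $\mathsf F$, reply $\mathsf F$), $\mathtt{get}$ (no change, reply is the content). Basic instructions are $f.m$ ($f$ register name, $m$ method). Primitive instructions: for each basic instruction $a$, the plain instruction $a$, positive test $+a$, negative test $-a$; forward jumps $\#l$ ($l\in\mathbb N$); termination $!$. An instruction sequence is a finite non-empty sequence $X=u_1;\dots;u_k$ of primitive instructions, $|X|=k$. Execution starts at $u_1$: $a$ executes $a$ and proceeds with the next instruction; $+a$ executes $a$ and proceeds with the next instruction if the reply is $\mathsf T$, otherwise skips the next instruction and proceeds with the one after; $-a$ likewise with reply roles reversed; $\#l$ proceeds with the $l$-th next instruction ($\#0$ causes inaction); $!$ terminates; if there is no instruction to proceed with, inaction occurs. $\mathcal{IS}_{br}$ is the set of instruction sequences whose basic instructions are all of the forms $\mathtt{in}{:}i.\mathtt{get}$, $\mathtt{aux}{:}i.\mathtt{get}$, $\mathtt{aux}{:}i.\mathtt{set{:}}b$, $\mathtt{out}.\mathtt{set{:}}b$ ($b\in\mathbb B$). $X$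 computes $f:\mathbb B^n\to\mathbb B$ if for all $b_1,\dots,b_n$, executing $X$ with $\mathtt{in}{:}i$ initially $b_i$ ($i\le n$) and all auxiliary registers and $\mathtt{out}$ initially $\mathsf F$, execution never executes an instruction on $\mathtt{in}{:}i$ with $i>n$, ends by executing $!$, and leaves $f(b_1,\dots,b_n)$ in $\mathtt{out}$. *)

(* Defs.v *)
From HB Require Import structures.
From mathcomp Require Import all_boot.
Set Implicit Arguments.
Unset Strict Implicit.
Unset Printing Implicit Defensive.

(* Register numbers start at 1. The index 0 is excluded by [is_br_basic]. *)
Inductive register := In of nat | Aux of nat | Out.

Definition register_code (r : register) : nat + nat + unit :=
  match r with
  | In i => inl (inl i)
  | Aux i => inl (inr i)
  | Out => inr tt
  end.

Definition register_decode (c : nat + nat + unit) : register :=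
  match c with
  | inl (inl i) => In i
  | inl (inr i) => Aux i
  | inr _ => Out
  end.

Lemma register_codeK : cancel register_code register_decode.
Proof. by case. Qed.

HB.instance Definition _ := Equality.copy register (can_type register_codeK).

Inductive method := Set_to of bool | Get.

Definition method_effect (m : method) (content : bool) : bool :=
  if m is Set_to b then b else content.

Definition method_reply (m : method) (content : bool) : bool :=
  if m is Set_to b then b else content.

Record basic_instr := Basic { focus : register; meth : method }.

Inductive instr :=
  | Plain of basic_instr
  | PosTest of basic_instr
  | NegTest of basic_instr
  | Jump of nat
  | Halt.

Definition state := register -> bool.

Definition update (a : basic_instr) (s : state) : state :=
  fun r => if r == focus a then method_effect (meth a) (s r) else s r.

Definition reply (a : basic_instr) (s : state) : bool :=
  method_reply (meth a) (s (focus a)).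

(* [executes X p s t s']: execution of [X] from 0-based position [p] in state
   [s] ends by executing [!] in state [s'], and [t] lists the basic
   instructions executed on the way. Inaction (jump of length 0, or position
   outside [X]) has no derivation. *)
Inductive executes (X : seq instr) :
    nat -> state -> seq basic_instr -> state -> Prop :=
  | ex_halt p s :
      onth X p = Some Halt ->
      executes X p s [::] s
  | ex_jump p l s t s' :
      onth X p = Some (Jump l) -> 0 < l ->
      executes X (p + l) s t s' ->
      executes X p s t s'
  | ex_plain p a s t s' :
      onth X p = Some (Plain a) ->
      executes X p.+1 (update a s) t s' ->
      executes X p s (a :: t) s'
  | ex_pos p a s t s' :
      onth X p = Some (PosTest a) ->
      executes X (if reply a s then p.+1 else p.+2) (update a s) t s' ->
      executes X p s (a :: t) s'
  | ex_neg p a s t s' :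
      onth X p = Some (NegTest a) ->
      executes X (if reply a s then p.+2 else p.+1) (update a s) t s' ->
      executes X p s (a :: t) s'.

Definition is_br_basic (a : basic_instr) : bool :=
  match focus a, meth a with
  | In i, Get => 0 < i
  | Aux i, _ => 0 < i
  | Out, Set_to _ => true
  | _, _ => false
  end.

Definition is_br_instr (u : instr) : bool :=
  match u with
  | Plain a | PosTest a | NegTest a => is_br_basic a
  | Jump _ | Halt => true
  end.

Definition IS_br (X : seq instr) : bool :=
  (0 < size X) && all is_br_instr X.

(* The contents of [In i] for [i > n] are unconstrained; [computes] forbids
   executing any instruction on these registers. *)
Definition initial n (b : n.-tuple bool) (s : state) : Prop :=
  [/\ forall i : 'I_n, s (In i.+1) = tnth b i,
      forall i, s (Aux i) = false &
      s Out = false].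

Definition within_inputs (n : nat) (a : basic_instr) : bool :=
  if focus a is In i then i <= n else true.

Definition computes n (X : seq instr) (f : n.-tuple bool -> bool) : Prop :=
  forall (b : n.-tuple bool) (s : state), initial b s ->
  exists t s', [/\ executes X 0 s t s', all (within_inputs n) t &
                   s' Out = f b].

(* Main.v *)
(* Let k = 2^n / n (rounded down), and let X, of length at most k, compute an
   n-ary function.  At most k auxiliary registers occur in X, so they can be
   renumbered by numbers below k; terminating executions use no jump of length
   k or more, and by hypothesis no input register beyond the n-th one.  So the
   function is also computed by a word of length k over an alphabet of
   10 k + 3 n + 7 letters, which is less than 2^n when n > 11.  There are fewer
   than 2^(n k) <= 2^(2^n) such words, and each computes at most one function. *)
Require Import Defs.
From mathcomp Require Import all_boot zify.
From Stdlib Require Import Classical.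

Set Implicit Arguments.
Unset Strict Implicit.
Unset Printing Implicit Defensive.

Lemma executes_onth X p s t s' : executes X p s t s' -> exists u, onth X p = Some u.
Proof. by case=> *; eexists; eassumption. Qed.

(** Determinism is what prevents one word from computing two different functions. *)
Lemma executes_det X p s t1 s1 t2 s2 :
  executes X p s t1 s1 -> executes X p s t2 s2 -> s1 = s2.
Proof.
move=> H; elim: H t2 s2 => {p s t1 s1} [p s Xp|p l s t s' Xp _ _ IH
  |p a s t s' Xp _ IH|p a s t s' Xp _ IH|p a s t s' Xp _ IH] t2 s2 H;
  inversion H; subst; try congruence; rewrite Xp in H0; case: H0 => ?; subst;
  exact: IH H1 || exact: IH H2.
Qed.

Section Letters.

Variables n k : nat.

Definition action : finType := ('I_n + 'I_k * option bool + bool)%type.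

Definition letter : finType := (action * option bool + option 'I_k)%type.

Lemma card_letter : #|letter| = 10 * k + 3 * n + 7.
Proof.
rewrite card_sum card_prod !card_option !card_sum card_prod card_option.
rewrite card_bool !card_ord; lia.
Qed.

(** Auxiliary registers are numbered from 0 here, so a decoded word may violate [IS_br]; only its
    executions matter. *)
Definition decode_action (x : action) : basic_instr :=
  match x with
  | inl (inl i) => Basic (In i.+1) Get
  | inl (inr (j, m)) => Basic (Aux j) (if m is Some b then Set_to b else Get)
  | inr b => Basic Out (Set_to b)
  end.

Definition decode (c : letter) : instr :=
  match c with
  | inl (x, None) => Plain (decode_action x)
  | inl (x, Some true) => PosTest (decode_action x)
  | inl (x, Some false) => NegTest (decode_action x)
  | inr (Some l) => Jump l
  | inr None => Halt
  end.

Variable L : seq nat.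

Definition encode_action (a : basic_instr) : option action :=
  match focus a, meth a with
  | In i, Get => omap (fun j : 'I_n => inl (inl j)) (insub i.-1)
  | Aux i, m =>
      let m' := if m is Set_to b then Some b else None in
      omap (fun j : 'I_k => inl (inr (j, m'))) (insub (index i L))
  | Out, Set_to b => Some (inr b)
  | _, _ => None
  end.

(* Instructions not reached in the executions of interest are encoded as [Halt]. *)
Definition encode (u : instr) : letter :=
  let test a b := if encode_action a is Some x then inl (x, b) else inr None in
  match u with
  | Plain a => test a None
  | PosTest a => test a (Some true)
  | NegTest a => test a (Some false)
  | Jump l => inr (insub l)
  | Halt => inr None
  end.

(** Simulation relation between a state [s] of the original program and a state [z] of the
    renumbered one: the new number of an auxiliary register is its first position in [L]. *)
Definition renamed (s z : state) : Prop :=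
  [/\ forall i, 0 < i <= n -> z (In i) = s (In i),
      forall i, i \in L -> z (Aux (index i L)) = s (Aux i) &
      z Out = s Out].

Definition aux_in (a : basic_instr) : bool :=
  if focus a is Aux i then i \in L else true.

Lemma encode_actionP a :
  size L <= k -> is_br_basic a -> within_inputs n a -> aux_in a ->
  exists2 x, encode_action a = Some x &
    forall s z, renamed s z ->
      reply (decode_action x) z = reply a s /\
      renamed (update a s) (update (decode_action x) z).
Proof.
case: a => r m Lk; rewrite /is_br_basic /within_inputs /aux_in /encode_action /=.
case: r m => [i|i|] [b|] //=.
- move=> i0 iN _; have iN' : i.-1 < n by lia.
  rewrite insubT; exists (inl (inl (Ordinal iN'))) => // s z [zI zA zO].
  rewrite /reply /update /= prednK //; split; first by apply: zI; rewrite i0.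
  by split=> // j *; rewrite /= ?zI ?zA ?zO //=; case: ifP.
- move=> _ _ iL; have iK : index i L < k by rewrite (leq_trans _ Lk) ?index_mem.
  rewrite insubT; exists (inl (inr (Ordinal iK, Some b))) => // s z [zI zA zO].
  split=> //; split=> //= j jL; rewrite /update /= zA //.
  (* Members of [L] with the same first position are equal, so renumbering merges no two registers
     in use. *)
  suff -> : (Aux (index j L) == Aux (index i L)) = (Aux j == Aux i) by [].
  apply/eqP/eqP=> [[e]|[->]] //.
  by rewrite -(nth_index 0 jL) e nth_index.
- move=> _ _ iL; have iK : index i L < k by rewrite (leq_trans _ Lk) ?index_mem.
  rewrite insubT; exists (inl (inr (Ordinal iK, None))) => // s z [zI zA zO].
  split; first exact: zA.
  by split=> [j H|j H|]; rewrite /update /= ?zI ?zA ?zO //; do 2?case: ifP.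
- move=> _ _ _; by exists (inr b) => // s z [zI zA zO]; split.
Qed.

End Letters.

(** The default 0 gives every instruction exactly one entry, so the list for [X] has length
    [size X]; a spurious 0 in it is harmless. *)
Definition aux_index (u : instr) : nat :=
  match u with
  | Plain (Basic (Aux i) _) | PosTest (Basic (Aux i) _)
  | NegTest (Basic (Aux i) _) => i
  | _ => 0
  end.

(** Sequences shorter than [k] are padded with [Halt], which gives all words the same length. *)
Definition code n k (X : seq instr) : k.-tuple (letter n k) :=
  [tuple encode n k (map aux_index X) (nth Halt X i) | i < k].

Definition program n k (c : k.-tuple (letter n k)) : seq instr :=
  map (@decode n k) c.

Lemma onth_code n k X p u : size X <= k -> onth X p = Some u ->
  onth (program (code n k X)) p = Some (decode (encode n k (map aux_index X) u)).
Proof.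
move=> Xk Xp; have pk : p < k by rewrite (leq_trans _ Xk) // -onthTE Xp.
rewrite /program onth_map onthE (nth_map (inr None)) ?size_tuple //.
have -> := esym (tnth_nth (inr None) (code n k X) (Ordinal pk)).
by rewrite tnth_mktuple /= (onth_nth Halt _ _ _ Xp).
Qed.

Lemma all_onth (T : Type) (P : pred T) s p u : all P s -> onth s p = Some u -> P u.
Proof. by elim: s p => [|x s IH] [|p] //= /andP[Px Ps]; [case=> <- | exact: IH]. Qed.

(** Induction on the terminating execution: only instructions actually reached have to be encoded
    faithfully. *)
Lemma executes_code n k X p s t s' z :
  all is_br_instr X -> size X <= k ->
  executes X p s t s' -> all (within_inputs n) t ->
  renamed n (map aux_index X) s z ->
  exists t' z', executes (program (code n k X)) p z t' z' /\ z' Out = s' Out.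
Proof.
move=> brX Xk; set L := map _ _.
have Lk : size L <= k by rewrite size_map.
have L_aux q u : onth X q = Some u -> aux_index u \in L.
  by move=> Xq; apply/onthP; exists q; rewrite onth_map Xq.
move=> H; elim: H z => {p s t s'} [p s Xp|p l s t s' Xp l0 H IH
  |p a s t s' Xp _ IH|p a s t s' Xp _ IH|p a s t s' Xp _ IH] z /=.
- move=> _ [_ _ zO]; exists [::], z; split=> //.
  by apply: ex_halt; rewrite (onth_code _ Xk Xp).
- move=> wt zR; have [t' [z' [H' zO]]] := IH z wt zR; exists t', z'; split=> //.
  have [u Xpl] := executes_onth H.
  (* The execution continues at [p + l], which therefore lies inside [X]. *)
  have lk : l < k.
    rewrite (leq_ltn_trans (leq_addl p l)) // (leq_trans _ Xk) //.
    by rewrite -onthTE Xpl.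
  by apply: ex_jump l0 H'; rewrite (onth_code _ Xk Xp) /= insubT.
all: move=> /andP[wa wt] zR.
all: have bra := all_onth brX Xp.
all: have aL : aux_in L a by case: (a) (L_aux _ _ Xp) => -[].
all: have [x ax /(_ _ _ zR)[rx xR]] := encode_actionP Lk bra wa aL.
all: have [t' [z' [H' zO]]] := IH _ wt xR.
all: exists (decode_action x :: t'), z'; split=> //.
all: have := onth_code n Xk Xp; rewrite /= ax /= => Yp.
- exact: ex_plain Yp H'.
- by apply: ex_pos Yp _; rewrite rx.
- by apply: ex_neg Yp _; rewrite rx.
Qed.

Lemma code_computes n k X (f : n.-tuple bool -> bool) :
  IS_br X -> size X <= k -> computes X f ->
  forall b s, initial b s ->
  exists t s', executes (program (code n k X)) 0 s t s' /\ s' Out = f b.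
Proof.
case/andP=> _ brX Xk Xf b s Hi; have [t [s' [H wt <-]]] := Xf b s Hi.
(* All auxiliary registers start with the same content, so an initial state is related to itself. *)
by apply: executes_code H wt _ => //; case: Hi => _ sA _; split=> // i _; rewrite !sA.
Qed.

Lemma exists_initial n (b : n.-tuple bool) : exists s, initial b s.
Proof.
exists (fun r => if r is In i then nth false b i.-1 else false).
by split=> // i; rewrite (tnth_nth false).
Qed.

Lemma card_words n (k := 2 ^ n %/ n) :
  11 < n -> (10 * k + 3 * n + 7) ^ k < 2 ^ (2 ^ n).
Proof.
move=> n11; have kn : k * n <= 2 ^ n := leq_divM _ _.
have k0 : 0 < k by rewrite divn_gt0 ?(ltnW (ltn_expl _ _)) //; lia.
(* Since [12 * k <= n * k <= 2 ^ n], the term [10 * k] takes at most five sixths of [2 ^ n]; the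
   rest must fit strictly in the last sixth. *)
have n6 : 6 * (3 * n + 7) < 2 ^ n.
  rewrite -(subnKC n11); elim: (n - 12) => // m IH.
  by rewrite addnS expnS; move: (2 ^ _) IH => N; lia.
have lt_A : 10 * k + 3 * n + 7 < 2 ^ n by nia.
apply: (@leq_trans ((2 ^ n) ^ k)); first by rewrite ltn_exp2r.
by rewrite -expnM leq_exp2l // mulnC.
Qed.

Theorem theorem3 (n : nat) (hn : 11 < n) :
  exists f : n.-tuple bool -> bool,
    forall X : seq instr, IS_br X -> computes X f -> 2 ^ n %/ n < size X.
Proof.
set k := 2 ^ n %/ n; apply: NNPP => no_f.
(* Finite functions are used so that words can be chosen for all of them at once and both sides
   counted. *)
have short (f : {ffun n.-tuple bool -> bool}) :
    exists c : k.-tuple (letter n k), forall b s, initial b s ->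
      exists t s', executes (program c) 0 s t s' /\ s' Out = f b.
  apply: NNPP => no_c; apply: no_f; exists f => X brX Xf.
  rewrite ltnNge; apply/negP => Xk; apply: no_c.
  by exists (code n k X); exact: code_computes.
have [w wP] := fin_all_exists short.
(* A shared word, run from a common initial state for [b], leaves both [f b] and [g b] in [Out]. *)
have /leq_card : injective w.
  move=> f g fg; apply/ffunP=> b; have [s si] := exists_initial b.
  have [t [s1 [H1 <-]]] := wP f b s si; have [t2 [s2 [H2 <-]]] := wP g b s si.
  by rewrite fg in H1; rewrite (executes_det H1 H2).
rewrite card_ffun !card_tuple card_letter card_bool leqNgt => /negP; apply.
exact: card_words.
Qed.
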